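(* Let $t \geq 1$ be an integer and let $G$ be a $(2t+1)$-regular graph. If $F_c(G) \leq 2 + \frac{2}{2t-1}$, then $G$ is a class 1 graph.
   Context: Graphs are finite multigraphs (parallel edges are allowed), with vertex set $V(G)$ and edge set $E(G)$. The edge-chromatic number $\chi'(G)$ is the least number of colors in a proper edge-coloring of $G$, and $\Delta(G)$ is the maximum vertex degree. $G$ is a class 1 graph if $\chi'(G) = \Delta(G)$, and a class 2 graph if $\chi'(G) > \Delta(G)$. For an orientation $D$ of $G$ and $v \in V(G)$, $E^+(v)$ is the set of edges with tail $v$ and $E^-(v)$ is the set of edges with head $v$. For a real number $r \geq 2$, a nowhere-zero $r$-flow on $G$ is an orientation $D$ of $G$ together with a function $\phi : E(G) \to \mathbb{R}$ such that $1 \leq |\phi(e)| \leq r-1$ for all $e \in E(G)$ and $\sum_{e \in E^+(v)}\phi(e) = \sum_{e \in E^-(v)}\phi(e)$ for all $v \in V(G)$. The circular flow number of $G$ is $F_c(G) = \inf\{ r : G \text{ has a nowhere-zero } r\text{-flow}\}$ (with $F_c(G)=\infty$ if $G$ has no nowhere-zero $r$-flow for any $r$). *)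

(* Defs.v *)
From HB Require Import structures.
From mathcomp Require Import all_boot all_order all_algebra.
From mathcomp Require Import boolp classical_sets reals constructive_ereal ereal.

Set Implicit Arguments.
Unset Strict Implicit.
Unset Printing Implicit Defensive.

Import Order.TTheory GRing.Theory Num.Theory.

(* Finite loopless multigraphs: distinct edges may have the same set of ends. *)
Record multigraph := Multigraph {
  vertex : finType;
  edge : finType;
  ends : edge -> {set vertex};
  ends_card : forall e, #|ends e| = 2
}.

Definition degree (G : multigraph) (v : vertex G) : nat :=
  #|[set e : edge G | v \in ends e]|.

Definition max_degree (G : multigraph) : nat := \max_(v : vertex G) degree v.

Definition regular (G : multigraph) (d : nat) : Prop :=
  forall v : vertex G, degree v = d.

Definition proper_edge_coloring (G : multigraph) (k : nat)
    (c : {ffun edge G -> 'I_k}) : bool :=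
  [forall e, forall f,
    (e != f) && ~~ [disjoint ends e & ends f] ==> (c e != c f)].

Definition edge_colorable (G : multigraph) (k : nat) : bool :=
  [exists c : {ffun edge G -> 'I_k}, proper_edge_coloring c].

Lemma edge_colorable_exists (G : multigraph) : exists k, edge_colorable G k.
Proof.
exists #|edge G|; apply/existsP; exists [ffun e => enum_rank e].
apply/forallP => e; apply/forallP => f; apply/implyP => /andP[nef _].
by rewrite !ffunE (inj_eq enum_rank_inj).
Qed.

Definition edge_chromatic_number (G : multigraph) : nat :=
  ex_minn (edge_colorable_exists G).

Definition class1 (G : multigraph) : Prop :=
  edge_chromatic_number G = max_degree G.

Record orientation (G : multigraph) := Orientation {
  tail : edge G -> vertex G;
  head : edge G -> vertex G;
  ends_tail_head : forall e, ends e = [set tail e; head e]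
}.

Local Open Scope ring_scope.

Definition is_nowhere_zero_flow (R : realType) (G : multigraph) (r : R)
    (D : orientation G) (phi : edge G -> R) : Prop :=
  (forall e, 1 <= `|phi e| <= r - 1) /\
  (forall v, \sum_(e | tail D e == v) phi e = \sum_(e | head D e == v) phi e).

Definition has_nowhere_zero_flow (R : realType) (G : multigraph) (r : R) : Prop :=
  2 <= r /\
  exists (D : orientation G) (phi : edge G -> R), is_nowhere_zero_flow r D phi.

(* The infimum is taken in the extended reals, so that it is +oo when there is
   no flow at all. *)
Definition circular_flow_number (R : realType) (G : multigraph) : \bar R :=
  ereal_inf [set r%:E | r in [set r : R | has_nowhere_zero_flow G r]]%classic.

(* Main.v *)
(* Scale a positive flow with values in [1, 1 + 2/(2t-1)] by 2t-1, so that the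
   values lie in [2t-1, 2t+1].  Balance at a vertex v forces its out-degree to be
   t or t+1; accordingly put s v = -1 or 1.  If g is the signed outflow moved by 2t
   towards 0, the half-edge weights w v e = 1 + s v * g v e are nonnegative and
   sum to 1 at v.  The two weights of an edge add up to 2 when s agrees at its ends
   and are equal otherwise.  So edges of the first kind have weight 1 at both ends
   and form a matching isolated in the support, while the remaining support is a
   bipartite graph with a fractional perfect matching, hence has a perfect matching
   by Hall.  Removing both matchings leaves a 2t-regular bipartite graph, which is
   2t-edge-colorable.  The infimum F_c(G) need not be known to be attained: all
   estimates survive a small error eps depending on |V(G)|. *)
Require Import Defs.
From HB Require Import structures.
From mathcomp Require Import all_boot all_order all_algebra.
From mathcomp Require Import boolp classical_sets reals constructive_ereal ereal.
From mathcomp Require Import fintype finset lra.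

Set Implicit Arguments.
Unset Strict Implicit.
Unset Printing Implicit Defensive.

Import Order.TTheory GRing.Theory Num.Theory.

Local Open Scope ring_scope.

(** * Hall's marriage theorem *)

(** Halmos-Vaughan induction on [#|A|]: split along a nonempty proper subset that meets Hall's bound
    with equality, or, if there is none, match one element arbitrarily. The codomain [option U]
    leaves room for an empty [U]. *)
Lemma hall_marriage (T U : finType) (A : {set T}) (N : T -> {set U}) :
  (forall X : {set T}, X \subset A -> (#|X| <= #|\bigcup_(x in X) N x|)%N) ->
  exists f : T -> option U,
    {in A &, injective f} /\ forall x, x \in A -> exists2 u, f x = Some u & u \in N x.
Proof.
have [n] := ubnP #|A|; elim: n A N => // n IHn A N /ltnSE leAn hallA.
have [A0|/set0Pn[a aA]] := eqVneq A set0.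
  by exists (fun=> None); split=> [x y|x]; rewrite A0 inE.
(* First case: a tight set [X]. It uses up all of its neighbours [NX], so [A :\: X] must be matched
   outside [NX]. *)
have [/existsP[X /and4P[XA X0 XnA /eqP cardX]]|/existsPn tight] := boolP
  [exists X : {set T}, [&& X \subset A, X != set0, X != A &
     #|X| == #|\bigcup_(x in X) N x|]].
  have [f1 [f1_inj f1N]] : exists f : T -> option U, {in X &, injective f} /\
      forall x, x \in X -> exists2 u, f x = Some u & u \in N x.
    apply: IHn => [|Y YX]; last exact: hallA _ (subset_trans YX XA).
    by apply: leq_trans leAn; apply: proper_card; rewrite properEneq XnA.
  set NX := \bigcup_(x in X) N x in cardX.
  have [|Y YAX|f2 [f2_inj f2N]] := IHn (A :\: X) (fun x => N x :\: NX).
  - apply: leq_trans leAn; apply: proper_card; rewrite properEneq subsetDl andbT.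
    have /set0Pn[x xX] := X0; apply/negP=> /eqP/setP/(_ x).
    by rewrite inE xX (subsetP XA).
  - have /subsetDP[YA dYX] := YAX.
    (* Hall's bound for [Y] outside [NX] is the bound for [X :|: Y] minus the equality for [X]. *)
    have := hallA (X :|: Y); rewrite subUset XA YA => /(_ isT).
    have -> : \bigcup_(x in X :|: Y) N x
        = NX :|: \bigcup_(x in Y) (N x :\: NX).
      apply/setP=> u; rewrite bigcup_setU -/NX !inE.
      case uNX: (u \in NX) => //=; apply/bigcupP/bigcupP=> -[y yY uy];
      exists y => //; first by rewrite inE uNX.
      by move: uy; rewrite inE uNX.
    have -> : #|X :|: Y| = (#|X| + #|Y|)%N.
      by rewrite cardsU disjoint_setI0 1?disjoint_sym// cards0 subn0.
    move=> /leq_trans/(_ (leq_card_setU _ _)).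
    by rewrite cardX leq_add2l.
  exists (fun x => if x \in X then f1 x else f2 x); split=> [x y xA yA|x xA].
    have f12 x1 x2 : x1 \in X -> x2 \in A -> x2 \notin X -> f1 x1 <> f2 x2.
      move=> x1X x2A x2X; have [u -> uN1] := f1N _ x1X.
      have [|u2 -> uN2 []] := f2N x2; first by rewrite inE x2X.
      move=> uu2; move: uN2; rewrite inE -uu2 => /andP[/negP + _]; apply.
      by apply/bigcupP; exists x1.
    case: ifPn => xX; case: ifPn => yX; first exact: f1_inj.
    - by move=> /(f12 _ _ xX yA yX).
    - by move=> /esym/(f12 _ _ yX xA xX).
    - by apply: f2_inj; rewrite inE ?xX ?yX.
  case: ifPn => xX; first exact: f1N.
  have [|u -> ] := f2N x; first by rewrite inE xX.
  by rewrite inE => /andP[_ uN]; exists u.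
have /card_gt0P[b bNa] : (0 < #|N a|)%N.
  by have := hallA [set a]; rewrite sub1set aA cards1 big_set1 => ->.
(* Second case: every nonempty proper subset has a spare neighbour, so losing [b] does no harm. *)
have [|Y YAa|f [f_inj fN]] := IHn (A :\ a) (fun x => N x :\ b).
- by move: leAn; rewrite (cardsD1 a) aA.
- have [->|Y0] := eqVneq Y set0; first by rewrite cards0.
  have YA : Y \subset A by apply: subset_trans YAa (subsetDl _ _).
  have YnA : Y != A.
    by apply/eqP=> YA'; move/subsetP: YAa => /(_ a); rewrite YA' !inE eqxx aA => /(_ isT).
  have := tight Y; rewrite YA Y0 YnA /= => nc.
  have := hallA _ YA; rewrite leq_eqVlt (negbTE nc) /= => ltY.
  have -> : \bigcup_(x in Y) (N x :\ b) = (\bigcup_(x in Y) N x) :\ b.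
    apply/setP=> u; rewrite !inE; apply/bigcupP/andP=> [[y yY]|[ub /bigcupP[y yY uy]]].
      by rewrite !inE => /andP[-> uy]; split=> //; apply/bigcupP; exists y.
    by exists y => //; rewrite !inE ub.
  by move: ltY; rewrite (cardsD1 b); case: (b \in _) => //= /ltnW.
exists (fun x => if x == a then Some b else f x); split=> [x y xA yA|x xA].
  have fb z : z \in A -> z != a -> f z <> Some b.
    move=> zA za; have [|u -> ] := fN z; first by rewrite !inE za.
    by rewrite !inE => /andP[/eqP ub _] [].
  case: eqVneq => [->|xa]; case: eqVneq => [->|ya] //.
  - by move=> /esym /(fb _ yA ya).
  - by move=> /(fb _ xA xa).
  - by apply: f_inj; rewrite !inE ?xa ?ya.
case: eqVneq => [->|xa]; first by exists b.
have [|u -> ] := fN x; first by rewrite !inE xa.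
by rewrite !inE => /andP[_ uN]; exists u.
Qed.

(** * Edge colorings and class 1 *)

Lemma class1_max_degree_colorable (G : multigraph) :
  edge_colorable G (max_degree G) -> class1 G.
Proof.
move=> colG; rewrite /class1 /edge_chromatic_number.
case: ex_minnP => m /existsP[c /forallP cP] minm.
apply/eqP; rewrite eqn_leq minm//=; apply/bigmax_leqP=> v _.
rewrite /degree -[m]card_ord -(card_in_imset (f := c)) ?max_card// => e f.
rewrite !inE => ve vf cef; apply/eqP; apply: contraT => nef.
have /forallP/(_ f) := cP e; rewrite nef cef eqxx /= implybF negbK.
by move=> /disjointFr/(_ ve); rewrite vf.
Qed.

Lemma edge_colorable_nat (G : multigraph) (k : nat) (c : edge G -> nat) :
  (forall e, c e < k)%N ->
  (forall e f v, v \in ends e -> v \in ends f -> c e = c f -> e = f) ->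
  edge_colorable G k.
Proof.
move=> ck cP; apply/existsP; exists [ffun e => Ordinal (ck e)].
apply/forallP=> e; apply/forallP=> f; apply/implyP=> /andP[nef].
rewrite disjoints_subset => /subsetPn[v ve]; rewrite inE negbK => vf.
by rewrite !ffunE; apply: contra nef => /eqP[/(cP _ _ _ ve vf) ->].
Qed.

(** Without vertices the maximum degree is 0 instead of [d]. The bound on a color is therefore drawn
    from an end of the colored edge, which exists as soon as there is an edge. *)
Lemma class1_of_regular_colorable (G : multigraph) (d : nat) :
  regular G d -> edge_colorable G d -> class1 G.
Proof.
move=> Greg /existsP[c /forallP cP]; apply: class1_max_degree_colorable.
apply: (@edge_colorable_nat _ _ (fun e => c e : nat)) => [e|e f v ve vf /val_inj cef].
  have /eqP/cards2P[x [y [_ ee]]] := ends_card e.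
  by apply: leq_trans (ltn_ord _) _; rewrite -{1}(Greg x); apply: leq_bigmax.
apply/eqP; apply: contraT => ef.
have /forallP/(_ f) := cP e; rewrite ef cef eqxx /= implybF negbK.
by move=> /disjointFr/(_ ve); rewrite vf.
Qed.

(** * Perfect matchings and edge colorings in bipartite graphs *)

(* Hall's condition is checked on the bipartite double cover of [H], so that the
   matching it yields maps [S] injectively, hence onto, itself. *)
Lemma near_fractional_perfect_matching (R : realFieldType) (G : multigraph)
    (L S : {set vertex G}) (H : {set edge G}) (w : edge G -> R) (d : R) :
  (forall e u v, e \in H -> ends e = [set u; v] -> (u \in L) != (v \in L)) ->
  (forall e, e \in H -> ends e \subset S) ->
  (forall e, e \in H -> 0 <= w e) ->
  0 <= d -> 2 * #|vertex G|%:R * d < 1 ->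
  (forall v, v \in S -> 1 - d <= \sum_(e in H | v \in ends e) w e <= 1 + d) ->
  exists2 M : {set edge G}, M \subset H &
    forall v, v \in S -> #|[set e in M | v \in ends e]| = 1%N.
Proof.
move=> HL HS w0 d0 dV wS.
pose N v := [set u | [exists e in H, ends e == [set v; u]]].
have Nsym u v : (u \in N v) = (v \in N u) by rewrite !inE setUC.
have NS v u : u \in N v -> u \in S.
  rewrite inE => /existsP[e /andP[/HS/subsetP eS /eqP ee]].
  by apply: eS; rewrite ee !inE eqxx orbT.
have double (X : {set vertex G}) :
    \sum_(v in X) \sum_(e in H | v \in ends e) w e =
    \sum_(e in H) w e * #|ends e :&: X|%:R.
  rewrite (exchange_big_dep (mem H)) /=; last by move=> v e _ /andP[].
  apply: eq_bigr => e eH; rewrite sumr_const [RHS]mulr_natr; congr (_ *+ _).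
  by apply: eq_card => v; rewrite !inE eH andbC.
have hallS (X : {set vertex G}) :
    X \subset S -> (#|X| <= #|\bigcup_(v in X) N v|)%N.
  move=> XS; set NX := \bigcup_(v in X) N v.
  have le1 : #|X|%:R * (1 - d) <= \sum_(v in X) \sum_(e in H | v \in ends e) w e.
    rewrite mulr_natl -sumr_const; apply: ler_sum => v vX.
    by have /andP[] := wS _ (subsetP XS _ vX).
  have le2 : \sum_(v in NX) \sum_(e in H | v \in ends e) w e <= #|NX|%:R * (1 + d).
    rewrite mulr_natl -sumr_const; apply: ler_sum => v /bigcupP[x xX /NS vS].
    by have /andP[] := wS _ vS.
  (* Each edge of [H] has at least as many ends in [NX] as in [X], since an end in [X] puts the
     opposite end in [NX]. *)
  have le3 : \sum_(v in X) \sum_(e in H | v \in ends e) w e <=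
             \sum_(v in NX) \sum_(e in H | v \in ends e) w e.
    rewrite !double; apply: ler_sum => e eH; apply: ler_wpM2l; first exact: w0.
    have /eqP/cards2P[x [y [xy ee]]] := ends_card e; rewrite ler_nat.
    have cardI (Y : {set vertex G}) : #|ends e :&: Y| = ((x \in Y) + (y \in Y))%N.
      rewrite (cardsD1 x) (cardsD1 y) !inE ee !inE !eqxx orbT.
      rewrite [y == x]eq_sym xy /= addnA.
      rewrite (_ : _ :\ y = set0) ?cards0 ?addn0//.
      by apply/setP=> z; rewrite !inE; case: (z == x); case: (z == y).
    have yNx : y \in N x by rewrite inE; apply/existsP; exists e; rewrite eH ee eqxx.
    have xNX : y \in X -> x \in NX.
      by move=> yX; apply/bigcupP; exists y => //; rewrite Nsym.
    have yNX : x \in X -> y \in NX by move=> xX; apply/bigcupP; exists x.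
    rewrite !cardI addnC; apply: leq_add.
      by case yX: (y \in X) => //; rewrite xNX.
    by case xX: (x \in X) => //; rewrite yNX.
  (* If [#|NX| < #|X|], the three estimates give [1 <= #|X| - #|NX| <= d * (#|X| + #|NX|) <= 2 *
     #|vertex G| * d < 1]. *)
  rewrite leqNgt; apply/negP=> lt.
  have : (#|NX| + 1)%:R <= #|X|%:R :> R by rewrite ler_nat addn1.
  have : #|X|%:R <= #|vertex G|%:R :> R by rewrite ler_nat max_card.
  rewrite natrD; move: le1 le2 le3 dV.
  set a : R := #|X|%:R; set b : R := #|NX|%:R; set c : R := #|vertex G|%:R.
  move=> le1 le2 le3 dV ac ba.
  have : a * d <= c * d by apply: ler_wpM2r.
  have : b * d <= c * d by apply: ler_wpM2r => //; lra.
  nra.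
have [f [f_inj fN]] := hall_marriage hallS.
have fS v : v \in S -> exists2 e, e \in H & exists2 u, f v = Some u & ends e = [set v; u].
  move=> /fN[u fv]; rewrite inE => /existsP[e /andP[eH /eqP ee]].
  by exists e => //; exists u.
(* The default [v] is never reached on [S]. *)
pose g v := odflt v (f v).
have gS v : v \in S -> g v \in S.
  by move=> vS; rewrite /g; have [u -> /NS] := fN _ vS.
have g_inj : {in S &, injective g}.
  move=> u v uS vS; rewrite /g => guv; apply: f_inj => //.
  by have [u' fu _] := fN _ uS; have [v' fv _] := fN _ vS; move: guv; rewrite fu fv /= => ->.
have gim : g @: S = S.
  apply/eqP; rewrite eqEcard card_in_imset// leqnn andbT.
  by apply/subsetP=> _ /imsetP[v vS ->]; apply: gS.
have [h hP] : exists h : vertex G -> option (edge G),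
    forall v, v \in S -> exists2 e, h v = Some e & e \in H /\ ends e = [set v; g v].
  exists (fun v => [pick e in H | ends e == [set v; g v]]) => v vS.
  case: pickP => [e /andP[eH /eqP ee]|no]; first by exists e.
  have [e eH [u fv ee]] := fS _ vS.
  by have := no e; rewrite eH ee /g fv eqxx.
(* Hall's theorem selects an edge at each vertex of [S], on both sides; only those selected from [L]
   are kept. Since [g] permutes [S] and exchanges the sides, each vertex of [S] outside [L] is [g x]
   for exactly one [x] in [L]. *)
pose M := [set e in H | [exists v in L :&: S, h v == Some e]].
exists M; first by apply/subsetP=> e; rewrite inE => /andP[].
have gL v : v \in S -> (g v \in L) = (v \notin L).
  move=> vS; have [e _ [eH ee]] := hP _ vS.
  by have := HL _ _ _ eH ee; case: (v \in L); case: (g v \in L).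
have ML v e : v \in S -> v \in L -> (e \in M) && (v \in ends e) = (h v == Some e).
  move=> vS vL; apply/andP/eqP=> [[]|hv].
    rewrite inE => /andP[eH /existsP[x /andP[]]].
    rewrite inE => /andP[xL xS] /eqP hx.
    have [e' he' [_ ee]] := hP _ xS; move: he'; rewrite hx => -[ee'].
    rewrite -ee' in ee; rewrite ee !inE => /orP[/eqP->//|/eqP vg].
    by move: vL; rewrite vg gL// xL.
  have [e' he' [e'H ee]] := hP _ vS; move: he'; rewrite hv => -[ee'].
  rewrite ee' ee !inE eqxx e'H /=; split=> //.
  by apply/existsP; exists v; rewrite inE vL vS hv ee' eqxx.
have MR v e : v \in S -> v \in L -> (e \in M) && (g v \in ends e) = (h v == Some e).
  move=> vS vL; apply/idP/idP=> [/andP[eM]|hv].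
    have := eM; rewrite inE => /andP[eH /existsP[x /andP[]]].
    rewrite inE => /andP[xL xS] /eqP hx.
    have [e' he' [_ ee]] := hP _ xS; move: he'; rewrite hx => -[ee'].
    rewrite -ee' in ee; rewrite ee !inE => /orP[/eqP gx|/eqP/(g_inj _ _ vS xS) ->].
      by move: xL; rewrite -gx gL// vL.
    by rewrite hx.
  have [e' he' [e'H ee]] := hP _ vS.
  have := hv; rewrite -ML// => /andP[-> _] /=.
  by move: hv; rewrite he' => /eqP[<-]; rewrite ee !inE eqxx orbT.
move=> v vS; have [vL|vL] := boolP (v \in L).
  have [e he _] := hP _ vS; apply/eqP/cards1P; exists e.
  by apply/setP=> e'; rewrite [in LHS]inE ML// he inE eq_sym.
have /imsetP[x xS vg] : v \in g @: S by rewrite gim.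
have xL : x \in L by move: vL; rewrite vg gL// negbK.
have [e he _] := hP _ xS; apply/eqP/cards1P; exists e.
by apply/setP=> e'; rewrite [in LHS]inE vg MR// he inE eq_sym.
Qed.

(** Perfect matchings are peeled off one at a time, each receiving a color of its own. Working with
    an edge set [H] of a fixed graph lets the induction delete edges without changing the graph. *)
Lemma regular_bipartite_edge_coloring (G : multigraph) (L : {set vertex G})
    (k : nat) (H : {set edge G}) :
  (forall e u v, e \in H -> ends e = [set u; v] -> (u \in L) != (v \in L)) ->
  (forall v, #|[set e in H | v \in ends e]| = k) ->
  exists2 c : edge G -> nat, (forall e, e \in H -> c e < k)%N &
    forall e f v, e \in H -> f \in H -> v \in ends e -> v \in ends f ->
      c e = c f -> e = f.
Proof.
elim: k H => [|k IHk] H HL degH.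
  have H0 e : e \notin H.
    have /eqP/cards2P[x [y [_ ee]]] := ends_card e.
    have /eqP := degH x; rewrite cards_eq0 => /eqP/setP/(_ e).
    by rewrite !inE ee !inE eqxx andbT => ->.
  by exists (fun=> 0%N) => [e|e f v] eH; have := H0 e; rewrite eH.
have k0 : k.+1%:R != 0 :> rat by rewrite pnatr_eq0.
(* The constant weight [1 / k.+1] is an exact fractional perfect matching, so the error is 0 and [S]
   is the whole vertex set. *)
have [|||||M MH Mdeg] := @near_fractional_perfect_matching rat G L setT H
    (fun=> k.+1%:R^-1) 0 HL.
- by move=> e _; apply: subsetT.
- by move=> e _; rewrite invr_ge0 ler0n.
- exact: lexx.
- by rewrite mulr0 ltr01.
- move=> v _.
  have -> : \sum_(e in H | v \in ends e) (k.+1%:R^-1 : rat) = 1.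
    have cardE : #|[pred e | (e \in H) && (v \in ends e)]| = k.+1.
      by rewrite -(degH v); apply: eq_card => e; rewrite !inE.
    by rewrite sumr_const cardE -[LHS]mulr_natr mulVf.
  by lra.
have [||c ck cP] := IHk (H :\: M).
- by move=> e u v; rewrite inE => /andP[_ /HL]; apply.
- move=> v; have := cardsID M [set e in H | v \in ends e].
  rewrite degH (_ : _ :&: M = [set e in M | v \in ends e]) ?Mdeg ?inE//.
    rewrite add1n => -[<-]; apply: eq_card => e; rewrite !inE.
    by rewrite andbA.
  apply/setP=> e; rewrite !inE; case eM: (e \in M); rewrite ?andbF//.
  by rewrite (subsetP MH) ?andbT.
exists (fun e => if e \in M then k else c e) => [e eH|e f v eH fH ve vf].
  by case: ifPn => // eM; apply/ltnW/ck; rewrite inE eM.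
case: ifPn => eM; case: ifPn => fM.
- move=> _; have /eqP/cards1P[x /setP xP] := Mdeg v (in_setT v).
  have := xP e; have := xP f; rewrite !inE eM fM ve vf /=.
  by move=> /esym/eqP-> /esym/eqP->.
- by move=> kc; have := ck f; rewrite inE fM fH -kc ltnn => /(_ isT).
- by move=> kc; have := ck e; rewrite inE eM eH kc ltnn => /(_ isT).
- by apply: (cP _ _ v) => //; rewrite inE ?eM ?fM.
Qed.

(** * From an almost extremal flow to an edge coloring *)

(* [f v e] is the flow leaving [v] along [e], scaled by [2t - 1]. *)
Lemma almost_extremal_flow_edge_coloring (R : realFieldType) (G : multigraph)
    (t : nat) (f : vertex G -> edge G -> R) (eps th d : R) :
  (1 <= t)%N -> regular G (2 * t + 1)%N ->
  (forall v, \sum_(e | v \in ends e) f v e = 0) ->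
  (forall e u v, ends e = [set u; v] -> f u e = - f v e) ->
  (forall v e, v \in ends e -> 2 * t%:R - 1 <= `|f v e| <= 2 * t%:R + 1 + eps) ->
  0 < eps -> 8 * t%:R * eps = th -> (2 * t%:R + 1) * th = d ->
  2 * #|vertex G|%:R * d < 1 -> d <= 2^-1 ->
  edge_colorable G (2 * t + 1)%N.
Proof.
move=> t1 Greg f_sum f_opp f_bnd eps0 epsE thE dV d2.
set T : R := t%:R in f_bnd epsE thE.
have T1 : 1 <= T by rewrite ler1n.
have th0 : 0 < th by nra.
have eps_th : 8 * eps <= th by nra.
have d_th : 3 * th <= d by nra.
(* The factor 8 in [epsE] serves here: [(2 * T + 1) * eps <= 4 * T * eps = th / 2]. *)
have eps_le : (2 * T + 1) * eps <= th / 2 by rewrite -epsE; lra.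
have th6 : th <= 6^-1 by lra.
have sum1 (v : vertex G) (x : R) : \sum_(e | v \in ends e) x = (2 * T + 1) * x.
  transitivity (\sum_(e in [set e | v \in ends e]) x).
    by apply: eq_bigl => e; rewrite inE.
  rewrite sumr_const (_ : #|_| = (2 * t + 1)%N); last exact: (Greg v).
  by rewrite -[LHS]mulr_natl natrD natrM.
pose s v := \sum_(e | v \in ends e) Num.sg (f v e).
pose g v e := f v e - 2 * T * Num.sg (f v e).
have g_opp e u v : ends e = [set u; v] -> g u e = - g v e.
  by move=> ee; rewrite /g (f_opp _ _ _ ee) sgrN; lra.
have g_bnd v e : v \in ends e -> `|g v e| <= 1 + eps.
  move=> /f_bnd/andP[fb1 fb2]; rewrite ler_norml /g; move: fb1 fb2.
  case: (ltrgt0P (f v e)) => fve fb1 fb2.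
  - by rewrite gtr0_sg//; lra.
  - by rewrite ltr0_sg//; lra.
  - by lra.
have g_sum v : \sum_(e | v \in ends e) g v e = - (2 * T * s v).
  by rewrite big_split /= f_sum add0r sumrN -mulr_sumr.
have s_bnd v : 2 * T * `|s v| <= (2 * T + 1) * (1 + eps).
  have -> : 2 * T * `|s v| = `|2 * T * s v|.
    by rewrite normrM (ger0_norm (_ : 0 <= 2 * T))//; lra.
  rewrite -normrN -g_sum -(sum1 v); apply: le_trans (ler_norm_sum _ _ _) _.
  exact: ler_sum (g_bnd v).
(* With [n] negative terms, [s v = 2t + 1 - 2n] is odd, and [s_bnd] keeps it strictly between -3 and
   3. *)
have s_pm v : s v = 1 \/ s v = -1.
  have sE : s v = 2 * T + 1 - 2 * #|[set e | (v \in ends e) && (f v e < 0)]|%:R.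
    rewrite -[2 * T + 1]mulr1 -(sum1 v) -sumr_const /s [in X in _ - 2 * X]big_mkcond.
    have -> : \sum_e (if e \in [set e | (v \in ends e) && (f v e < 0)] then 1 else 0)
       = \sum_(e | v \in ends e) (f v e < 0)%R%:R :> R.
      rewrite [RHS]big_mkcond /=; apply: eq_bigr => e _.
      by rewrite inE; case: (v \in ends e); case: (f v e < 0).
    rewrite mulr_sumr -sumrB; apply: eq_bigr => e /f_bnd/andP[fe _].
    case: (ltrgt0P (f v e)) fe => fve fe.
    - by rewrite gtr0_sg// mulr0 subr0.
    - by rewrite ltr0_sg//= mulr1; lra.
    - by lra.
  set n := #|_| in sE.
  have := s_bnd v; rewrite sE => sb.
  have s3 : `|2 * T + 1 - 2 * n%:R| < 3 by nra.
  move: s3; rewrite ltr_norml => /andP[s3 s3'].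
  have : (n < t + 2)%N by rewrite -(ltr_nat R) natrD -/T; lra.
  have : (t < n + 1)%N by rewrite -(ltr_nat R) natrD -/T; lra.
  rewrite addn1 addn2 !ltnS => tn nt.
  have [->|nt'] := eqVneq n t; first by left; rewrite -/T; lra.
  have -> : n = t.+1 by apply/eqP; rewrite eqn_leq nt ltn_neqAle eq_sym nt'.
  by right; rewrite -[t.+1]addn1 natrD -/T; lra.
pose w v e := 1 + s v * g v e.
(* The sum is [2T + 1 - 2T * (s v)^2], where [(s v)^2 = 1]. *)
have w_sum v : \sum_(e | v \in ends e) w v e = 1.
  rewrite big_split /= sum1 -mulr_sumr g_sum.
  by case: (s_pm v) => ->; lra.
have w_ge v e : v \in ends e -> - eps <= w v e.
  move=> /g_bnd; rewrite ler_norml /w => /andP[? ?].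
  by case: (s_pm v) => ->; lra.
have part_cst (v : vertex G) (P : pred (edge G)) (x : R) : 0 <= x ->
    \sum_(e | (v \in ends e) && P e) x <= (2 * T + 1) * x.
  by move=> x0; rewrite -(sum1 v) [leRHS](bigID P) /= lerDl sumr_ge0.
(* The omitted weights are each at least [- eps], and there are at most [2t + 1] of them. *)
have part_le v (P : pred (edge G)) :
    \sum_(e | (v \in ends e) && P e) w v e <= 1 + (2 * T + 1) * eps.
  have := w_sum v; rewrite (bigID P) /=.
  have := part_cst v (predC P) _ (ltW eps0) => /=.
  have : 0 <= \sum_(e | (v \in ends e) && ~~ P e) (w v e + eps).
    by apply: sumr_ge0 => e /andP[/w_ge + _]; lra.
  by rewrite big_split /=; lra.
have w_le v e : v \in ends e -> w v e <= 1 + (2 * T + 1) * eps.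
  move=> ve; have := part_le v (pred1 e).
  by rewrite (big_pred1 e)// => e'; rewrite /= andbC; case: eqP => // ->.

pose L := [set v | s v == 1].
have N1 : (-1 == 1 :> R) = false by apply/eqP; lra.
have s_L u v : (u \in L) = (v \in L) -> s u = s v.
  by rewrite !inE; case: (s_pm u) => ->; case: (s_pm v) => ->; rewrite ?eqxx ?N1.
have s_nL u v : (u \in L) != (v \in L) -> s u = - s v.
  by rewrite !inE; case: (s_pm u) => ->; case: (s_pm v) => ->; rewrite ?eqxx ?opprK.
have [M0 M0E] : exists M0 : {set edge G}, forall e u v,
    ends e = [set u; v] -> (e \in M0) = ((u \in L) == (v \in L)).
  exists [set e | (ends e \subset L) || [disjoint ends e & L]] => e u v ee.
  rewrite inE ee subUset !sub1set disjoints_subset subUset !sub1set.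
  by rewrite !inE; case: (s u == 1); case: (s v == 1).
(* When [s] agrees at the two ends, the antisymmetry of [g] makes the two weights add up to 2, so
   the upper bound [w_le] at one end is a lower bound at the other. *)
have w_M0 e v : e \in M0 -> v \in ends e -> 1 - (2 * T + 1) * eps <= w v e.
  have /eqP/cards2P[x [y [xy ee]]] := ends_card e.
  rewrite (M0E _ _ _ ee) => /eqP/s_L sxy.
  have gxy := g_opp _ _ _ ee.
  have xe : x \in ends e by rewrite ee !inE eqxx.
  have ye : y \in ends e by rewrite ee !inE eqxx orbT.
  have := w_le _ _ xe; have := w_le _ _ ye; rewrite /w gxy sxy => ? ?.
  by rewrite ee !inE => /orP[] /eqP->; rewrite ?gxy ?sxy; lra.
have w_sym e u v : e \notin M0 -> ends e = [set u; v] -> w u e = w v e.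
  move=> eM ee; move: eM; rewrite (M0E _ _ _ ee) => /s_nL suv.
  by rewrite /w suv (g_opp _ _ _ ee); lra.
(* Together [e] and [m] weigh at most [1 + (2T + 1) * eps] at [v], and [m] alone at least
   [1 - (2T + 1) * eps]; the difference is at most [th]. *)
have w_beside_M0 e m v : m \in M0 -> e != m -> v \in ends m -> v \in ends e ->
    w v e <= th.
  move=> mM em vm ve; have := part_le v (pred2 e m); rewrite (bigD1 e) /=; last first.
    by rewrite ve eqxx.
  rewrite (big_pred1 m) => [|e'].
    by have := w_M0 _ _ mM vm; lra.
  rewrite /=; case: (eqVneq e' m) => [->|]; first by rewrite vm eq_sym em orbT.
  by case: (eqVneq e' e); rewrite ?andbF.
have M0_uniq e m v : e \in M0 -> m \in M0 -> v \in ends e -> v \in ends m -> e = m.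
  move=> eM mM ve vm; apply/eqP/negPn/negP => em.
  by have := w_beside_M0 _ _ _ mM em vm ve; have := w_M0 _ _ eM ve; lra.
(* Averaging over the ends avoids choosing one; outside [M0] the two weights coincide. *)
pose W e := (\sum_(v in ends e) w v e) / 2.
have WE e v : e \notin M0 -> v \in ends e -> W e = w v e.
  have /eqP/cards2P[x [y [xy ee]]] := ends_card e => eM.
  have wxy := w_sym _ _ _ eM ee.
  rewrite /W ee big_setU1 ?inE// big_set1 wxy => /orP[] /eqP->; rewrite ?wxy /=; lra.
(* The cutoff [th] replaces the exact support: it excludes every edge that touches [M0], and costs a
   vertex at most [(2T + 1) * th = d] in weight. *)
pose H := [set e | (e \notin M0) && (th < W e)].
pose S := [set v | ~~ [exists m in M0, v \in ends m]].
have HL e u v : e \notin M0 -> ends e = [set u; v] -> (u \in L) != (v \in L).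
  by move=> + ee; rewrite (M0E _ _ _ ee).
have HS e : e \in H -> ends e \subset S.
  rewrite inE => /andP[eM We]; apply/subsetP => v ve.
  rewrite inE; apply/existsPn => m; apply/negP => /andP[mM vm].
  have em : e != m by apply: contraNneq eM => ->.
  by have := w_beside_M0 _ _ _ mM em vm ve; rewrite -WE// leNgt We.
have [||||M1 M1H M1_deg] := near_fractional_perfect_matching (L := L) (w := W) _ HS _ _ dV.
- by move=> e u v; rewrite inE => /andP[/HL + _]; apply.
- by move=> e; rewrite inE => /andP[_ We]; apply/ltW/(lt_trans th0).
- by lra.
- move=> v vS.
  have notM0 e : v \in ends e -> e \notin M0.
    move=> ve; apply/negP => eM; move: vS; rewrite inE => /existsP[].
    by exists e; rewrite eM.
  have -> : \sum_(e in H | v \in ends e) W e =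
            \sum_(e | (v \in ends e) && (e \in H)) w v e.
    apply: eq_big => [e|e /andP[eH ve]]; first by rewrite andbC.
    by rewrite (WE _ v)// notM0.
  have up := part_le v (mem H); apply/andP; split; last by move: up => /=; lra.
  have := w_sum v; rewrite (bigID (mem H)) /=.
  have : \sum_(e | (v \in ends e) && (e \notin H)) w v e <=
         \sum_(e | (v \in ends e) && (e \notin H)) th.
    apply: ler_sum => e /andP[ve]; rewrite inE notM0//= -leNgt.
    by rewrite (WE _ v)// notM0.
  have := part_cst v (predC (mem H)) _ (ltW th0) => /=.
  by rewrite thE; lra.
(* [M0] covers exactly the vertices outside [S], and [M1] those in [S], so [M] is a perfect
   matching. *)
pose M := M0 :|: M1.
have M_deg v : #|[set e in M | v \in ends e]| = 1%N.
  have [vS|] := boolP (v \in S).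
    rewrite -(M1_deg _ vS); apply: eq_card => e; rewrite !inE.
    case ve: (v \in ends e); rewrite ?andbF// !andbT.
    suff /negbTE-> : e \notin M0 by rewrite ?andbT.
    by apply/negP => eM; move: vS; rewrite inE => /existsP[]; exists e; rewrite eM.
  move=> vS; have := vS; rewrite inE negbK => /existsP[m /andP[mM vm]].
  apply/eqP/cards1P; exists m; apply/setP => e; rewrite !inE.
  apply/andP/eqP => [[/orP[eM|eM1] ve]|->]; last by rewrite mM.
    exact: M0_uniq ve vm.
  by move: vS; rewrite (subsetP (HS _ (subsetP M1H _ eM1))).
(* All edges within a side lie in [M0], so the complement of [M] is bipartite, and it is
   [2t]-regular. The last color, [2t], goes to [M]. *)
have [||c ck cP] := @regular_bipartite_edge_coloring G L (2 * t) (~: M).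
- by move=> e u v; rewrite in_setC in_setU negb_or => /andP[/HL + _]; apply.
- move=> v; have := cardsID M [set e | v \in ends e].
  rewrite [RHS](Greg v) addn1 (_ : _ :&: M = [set e in M | v \in ends e]).
    by rewrite M_deg add1n => -[<-]; apply: eq_card => e; rewrite !inE.
  by apply/setP => e; rewrite !inE andbC.
apply: (@edge_colorable_nat _ _ (fun e => if e \in M then (2 * t)%N else c e)).
  by move=> e; rewrite addn1 ltnS; case: ifPn => // eM; rewrite ltnW// ck// inE.
move=> e h v ve vh; case: ifPn => eM; case: ifPn => hM.
- have /eqP/cards1P[x /setP xP] := M_deg v => _.
  have := xP e; have := xP h; rewrite !(inE, eM, hM, ve, vh) /=.
  by move=> /esym/eqP-> /esym/eqP->.
- by move=> tc; have := ck h; rewrite inE hM -tc ltnn => /(_ isT).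
- by move=> tc; have := ck e; rewrite inE eM tc ltnn => /(_ isT).
- by apply: (cP _ _ v) => //; rewrite inE ?eM ?hM.
Qed.

(** * Passage from the circular flow number to an almost extremal flow *)

Theorem corollary2p5 (R : realType) (t : nat) (ht : (1 <= t)%N)
    (G : multigraph) (hreg : regular G (2 * t + 1)%N)
    (hF : (circular_flow_number R G <= (2 + 2 / (2 * t%:R - 1))%:E)%E) :
  class1 G.
Proof.
apply: (class1_of_regular_colorable hreg).
set T : R := t%:R in hF *; have T1 : 1 <= T by rewrite ler1n.
have T0 : 0 < 2 * T - 1 by lra.
pose N : R := #|vertex G|%:R; have N0 : 0 <= N by rewrite ler0n.
(* This [d] gives both [2 * N * d < 1] and [d <= 1/2], even when [N = 0]. *)
pose d := (2 * N + 2)^-1; pose th := d / (2 * T + 1); pose eps := th / (8 * T).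
have dE : (2 * N + 2) * d = 1 by rewrite mulfV// gt_eqF//; lra.
have d0 : 0 < d by rewrite invr_gt0; lra.
have th0 : 0 < th by rewrite divr_gt0//; lra.
have eps0 : 0 < eps by rewrite divr_gt0//; lra.
(* The slack is [eps] divided by the scaling factor, so that [(2T - 1) * (r - 1) < 2T + 1 + eps]. *)
have [r flow_r ltr] : exists2 r : R, has_nowhere_zero_flow G r &
    r < 2 + 2 / (2 * T - 1) + eps / (2 * T - 1).
  have /ereal_inf_lt[_ [r /= flow_r <-]] : (circular_flow_number R G <
      (2 + 2 / (2 * T - 1) + eps / (2 * T - 1))%:E)%E.
    by apply: le_lt_trans hF _; rewrite lte_fin ltrDl divr_gt0.
  by rewrite lte_fin => ltr; exists r.
have [_ [D [phi [phi_bnd phi_sum]]]] := flow_r.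
have tail_head e : tail D e != Defs.head D e.
  by have := ends_card e; rewrite (ends_tail_head D) cards2; case: eqP.
(* [phi] may be negative. No reorientation is made, because the sign of [f v e] already records the
   direction in which the flow actually runs. *)
pose f v e := (2 * T - 1) * ((tail D e == v)%:R * phi e - (Defs.head D e == v)%:R * phi e).
apply: (@almost_extremal_flow_edge_coloring R G t f eps th d) => //.
- move=> v; rewrite -mulr_sumr sumrB.
  have restrict (h : edge G -> vertex G) : (forall e, h e \in ends e) ->
      \sum_(e | v \in ends e) (h e == v)%:R * phi e = \sum_(e | h e == v) phi e.
    move=> hP; rewrite big_mkcond [RHS]big_mkcond; apply: eq_bigr => e _ /=.
    by case: eqP => [<-|_]; rewrite ?hP ?mul1r ?mul0r ?if_same.
  rewrite !restrict ?phi_sum ?subrr ?mulr0// => e;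
    by rewrite (ends_tail_head D) !inE eqxx ?orbT.
- move=> e u v; rewrite (ends_tail_head D) /f => ee.
  have := tail_head e.
  have : tail D e \in [set u; v] by rewrite -ee !inE eqxx.
  have : Defs.head D e \in [set u; v] by rewrite -ee !inE eqxx orbT.
  rewrite !inE => /orP[] /eqP-> /orP[] /eqP->; rewrite ?eqxx// => uv;
    by rewrite (negbTE uv) [_ == _]eq_sym (negbTE uv) /=; lra.
- move=> v e ve; have /andP[phi1 phi2] := phi_bnd e.
  have -> : `|f v e| = (2 * T - 1) * `|phi e|.
    rewrite normrM (gtr0_norm T0); congr (_ * _).
    have := tail_head e; move: ve; rewrite (ends_tail_head D) !inE => /orP[] /eqP->.
      by rewrite eqxx eq_sym => /negbTE->; rewrite mul1r mul0r subr0.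
    by move=> /negbTE->; rewrite eqxx mul1r mul0r sub0r normrN.
  apply/andP; split; first by rewrite -[leLHS]mulr1 ler_pM2l.
  have : (2 * T - 1) * `|phi e| <= (2 * T - 1) * (r - 1) by rewrite ler_pM2l.
  have : (2 * T - 1) * r <= (2 * T - 1) * (2 + 2 / (2 * T - 1) + eps / (2 * T - 1)).
    by rewrite ler_pM2l// ltW.
  rewrite !mulrDr (mulrC _ (2 / _)) (mulrC _ (eps / _)) !divfK ?gt_eqF//; lra.
- by rewrite /eps mulrC divfK// mulf_neq0 ?pnatr_eq0// gt_eqF//; lra.
- by rewrite /th mulrC divfK// gt_eqF//; lra.
- by rewrite -/N; lra.
- by nra.
Qed.
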